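(* (i) The class of varieties $\mathcal V$ such that every tolerance in every algebra in $\mathcal V$ is representable cannot be characterized by a weak Mal'cev condition. (ii) The class of varieties $\mathcal V$ such that every tolerance in every algebra in $\mathcal V$ is weakly representable cannot be characterized by a weak Mal'cev condition.
   Context: A binary relation on (the universe $A$ of) an algebra $\mathbf A$ is compatible (also called admissible) if it is preserved by all basic operations of $\mathbf A$. A tolerance of $\mathbf A$ is a reflexive, symmetric, compatible binary relation on $\mathbf A$. For binary relations $R,S$ on $A$, $R\circ S=\{(x,y): \exists z\ (x,z)\in R,\ (z,y)\in S\}$, and $R^-$ denotes the converse of $R$. A tolerance $\Theta$ of $\mathbf A$ is representable if and only if there exists a compatible and reflexive relation $R$ on $\mathbf A$ such that $\Theta=R\circ R^-$. It is weakly representable if and only if there exist a set $K$ (possibly infinite) and compatible reflexive relations $R_k$ ($k\in K$) on $\mathbf A$ such that $\Theta=\bigcap_{k\in K}(R_k\circ R_k^-)$. A strong Mal'cev condition asserts that a variety has finitely many terms satisfying a given finite set of identities. A Mal'cev condition is given by a sequence $\mathcal M_0,\mathcal M_1,\dots$ of strong Mal'cev conditions with each $\mathcal M_n$ implying $\mathcal M_{n+1}$, and is satisfied by a variety if some $\mathcal M_n$ is. A weak Mal'cev condition is a conjunction of countably many Mal'cev conditions. A class of varieties is characterized by a condition $\mathcal M$ if it consists exactly of the varieties satisfying $\mathcal M$. *)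

(* Defs.v *)
From mathcomp Require Import all_boot.
From mathcomp Require Import boolp classical_sets.

Set Implicit Arguments.
Unset Strict Implicit.
Unset Printing Implicit Defensive.

Local Open Scope classical_set_scope.

(* Operation symbols are finitary; nullary symbols are allowed and there may
   be infinitely many symbols. Algebras are nonempty. *)
Record signature := Signature {
  symbol :> Type;
  arity : symbol -> nat }.

Record algebra (S : signature) := Algebra {
  carrier :> Type;
  oper : forall f : S, ('I_(arity f) -> carrier) -> carrier;
  carrier_inhabited : inhabited carrier }.

Inductive term (S : signature) (X : Type) : Type :=
| Var of X
| App (f : S) of ('I_(arity f) -> term S X).

Arguments Var {S X}.
Arguments App {S X}.

Fixpoint eval (S : signature) (A : algebra S) (X : Type) (e : X -> A)
    (t : term S X) : A :=
  match t with
  | Var x => e x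
  | App f ts => oper (fun i => eval e (ts i))
  end.

Fixpoint subst (S : signature) (X Y : Type) (s : X -> term S Y)
    (t : term S X) : term S Y :=
  match t with
  | Var x => s x
  | App f ts => App f (fun i => subst s (ts i))
  end.

(* [interp d t] replaces each symbol [f] of [S] in [t] by the [T]-term [d f],
   whose variables are the argument places of [f]. *)
Fixpoint interp (S T : signature) (d : forall f : S, term T 'I_(arity f))
    (X : Type) (t : term S X) : term T X :=
  match t with
  | Var x => Var x
  | App f ts => subst (fun i => interp d (ts i)) (d f)
  end.

Record identity (S : signature) := Identity {
  ident_lhs : term S nat;
  ident_rhs : term S nat }.

Definition interp_identity (S T : signature)
    (d : forall f : S, term T 'I_(arity f)) (p : identity S) : identity T :=
  Identity (interp d (ident_lhs p)) (interp d (ident_rhs p)).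

Definition holds (S : signature) (A : algebra S) (p : identity S) : Prop :=
  forall e : nat -> A, eval e (ident_lhs p) = eval e (ident_rhs p).

Definition models (S : signature) (E : identity S -> Prop) (A : algebra S) :
    Prop :=
  forall p, E p -> holds A p.

(* A variety is a class of algebras of one type definable by identities. *)
Record variety := Variety {
  var_sig : signature;
  var_class : algebra var_sig -> Prop;
  var_equational : exists E : identity var_sig -> Prop,
    forall A, var_class A <-> models E A }.

Section Tolerances.
Variables (S : signature) (A : algebra S).
Implicit Types R Theta : set (A * A).

Definition compatible_rel R : Prop :=
  forall (f : S) (a b : 'I_(arity f) -> A),
    (forall i, R (a i, b i)) -> R (oper a, oper b).

Definition reflexive_rel R : Prop := forall x, R (x, x).

Definition symmetric_rel R : Prop := forall x y, R (x, y) -> R (y, x).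

Definition tolerance Theta : Prop :=
  [/\ reflexive_rel Theta, symmetric_rel Theta & compatible_rel Theta].

Definition representable Theta : Prop :=
  exists R, [/\ compatible_rel R, reflexive_rel R &
    Theta = (R \; R^-1)%relation].

Definition weakly_representable Theta : Prop :=
  exists (K : Type) (R : K -> set (A * A)),
    (forall k, compatible_rel (R k) /\ reflexive_rel (R k)) /\
    Theta = \bigcap_(k in [set: K]) (R k \; (R k)^-1)%relation.

End Tolerances.

(* Terms [t_i], for [i < strong_size], of the given arities are required to
   exist; the identities they must satisfy are written with one formal symbol
   per [t_i], and may contain nested symbols. *)
Record strong_malcev := StrongMalcev {
  strong_size : nat;
  strong_arity : 'I_strong_size -> nat;
  strong_nb_idents : nat;
  strong_ident : 'I_strong_nb_idents -> identity (Signature strong_arity) }.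

Definition satisfies_strong (V : variety) (M : strong_malcev) : Prop :=
  exists d : forall i, term (var_sig V) 'I_(@strong_arity M i),
    forall j (A : algebra (var_sig V)), var_class A ->
      holds A
        (@interp_identity (Signature (@strong_arity M)) (var_sig V) d
           (@strong_ident M j)).

Record malcev := Malcev {
  malcev_seq :> nat -> strong_malcev;
  malcev_seq_implies : forall n (V : variety),
    satisfies_strong V (malcev_seq n) -> satisfies_strong V (malcev_seq n.+1) }.

Definition satisfies_malcev (V : variety) (M : malcev) : Prop :=
  exists n, satisfies_strong V (M n).

(* Conjunctions indexed by [nat] include the finite ones, by repetition. *)
Definition weak_malcev := nat -> malcev.

Definition satisfies_weak_malcev (V : variety) (M : weak_malcev) : Prop :=
  forall m, satisfies_malcev V (M m).

Definition characterized_by (C : variety -> Prop) (M : weak_malcev) : Prop :=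
  forall V, C V <-> satisfies_weak_malcev V M.

Definition all_tolerances_representable (V : variety) : Prop :=
  forall A : algebra (var_sig V), var_class A ->
  forall Theta : set (A * A), tolerance Theta -> representable Theta.

Definition all_tolerances_weakly_representable (V : variety) : Prop :=
  forall A : algebra (var_sig V), var_class A ->
  forall Theta : set (A * A), tolerance Theta -> weakly_representable Theta.

(* Main.v *)
From mathcomp Require Import all_boot.
From mathcomp Require Import boolp classical_sets.
Require Import Defs.

Set Implicit Arguments.
Unset Strict Implicit.
Unset Printing Implicit Defensive.

Local Open Scope classical_set_scope.

(** Weak Mal'cev conditions only ask for the existence of terms, so they are
    inherited by every variety in which a variety satisfying them can be
    interpreted ([satisfies_weak_malcev_interp]); in particular, adding
    operations to a variety preserves them. Representability of tolerances is
    not preserved in this way, because added operations can destroy the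
    compatibility of the relations [R] that represent a tolerance, while
    keeping the tolerance itself compatible.

    The separating example starts from lattices. In a lattice every tolerance
    [Theta] is [R \; R^-1], where [R] is the set of pairs [x <= y] in [Theta]
    ([lattice_tolerances_representable]). Now expand lattices by two
    arbitrary unary operations, and consider the chain [Lo < Mid < Hi] with the
    tolerance that relates all pairs except [Lo] and [Hi]. The two maps
    [flip] and [swap] preserve this tolerance, but every compatible reflexive
    [R] with [Lo] and [Mid] related by [R \; R^-1] also has [Lo] and [Hi]
    related by it ([forced_pair]). Hence no intersection of such relations is
    the tolerance, which is therefore not even weakly representable. Lattices
    and their expansion thus refute both characterizations at once. *)

(** * Interpretations and Mal'cev conditions *)

Lemma eval_subst (S : signature) (A : algebra S) (X Y : Type) (e : Y -> A)
    (s : X -> term S Y) (t : term S X) :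
  eval e (subst s t) = eval (fun x => eval e (s x)) t.
Proof.
elim: t => //= f ts IH; congr (oper _).
exact/funext.
Qed.

Definition reduct (S T : signature) (d : forall f : S, term T 'I_(arity f))
    (A : algebra T) : algebra S :=
  @Algebra S A (fun f a => eval a (d f)) (carrier_inhabited A).

Lemma eval_interp (S T : signature) (d : forall f : S, term T 'I_(arity f))
    (A : algebra T) (X : Type) (e : X -> A) (t : term S X) :
  eval e (interp d t) = @eval S (reduct d A) X e t.
Proof.
elim: t => //= f ts IH; rewrite eval_subst.
by congr (eval _ _); apply/funext.
Qed.

Lemma holds_interp (S T : signature) (d : forall f : S, term T 'I_(arity f))
    (A : algebra T) (p : identity S) :
  holds A (interp_identity d p) <-> holds (reduct d A) p.
Proof. by split=> h e; move: (h e); rewrite /= !eval_interp. Qed.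

Lemma reduct_comp (S T U : signature) (d : forall f : S, term T 'I_(arity f))
    (d' : forall f : T, term U 'I_(arity f)) (A : algebra U) :
  reduct (fun f => interp d' (d f)) A = reduct d (reduct d' A).
Proof.
rewrite /reduct; congr Algebra.
apply: functional_extensionality_dep => f; apply/funext => a.
exact: eval_interp.
Qed.

Definition reduct_class (V : variety) (T : signature)
    (d : forall f : var_sig V, term T 'I_(arity f)) (A : algebra T) : Prop :=
  var_class (reduct d A).

Lemma reduct_class_equational (V : variety) (T : signature)
    (d : forall f : var_sig V, term T 'I_(arity f)) :
  exists E : identity T -> Prop, forall A, reduct_class d A <-> models E A.
Proof.
have [E hE] := var_equational V.
exists (fun p => exists2 q, E q & p = interp_identity d q) => A.
rewrite /reduct_class hE; split=> [h _ [q Eq ->]|h q Eq].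
  exact/holds_interp/h.
by apply/holds_interp/h; exists q.
Qed.

(** The largest variety of type [T] in which [V] is interpreted by [d]. *)
Definition interpreting_variety (V : variety) (T : signature)
    (d : forall f : var_sig V, term T 'I_(arity f)) : variety :=
  Variety (reduct_class_equational d).

(** Translating the witnessing terms along the interpretation is enough: in
    each algebra the translated identities say what the original ones say in
    its reduct. *)
Lemma satisfies_strong_interp (V W : variety)
    (d : forall f : var_sig V, term (var_sig W) 'I_(arity f))
    (M : strong_malcev) :
  (forall A, var_class A -> var_class (reduct d A)) ->
  satisfies_strong V M -> satisfies_strong W M.
Proof.
move=> VW [t ht]; exists (fun i => interp d (t i)) => j A WA.
apply/holds_interp.
rewrite (@reduct_comp (Signature (@strong_arity M))).
exact/holds_interp/ht/VW.
Qed.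

Lemma satisfies_weak_malcev_interp (V W : variety)
    (d : forall f : var_sig V, term (var_sig W) 'I_(arity f))
    (M : weak_malcev) :
  (forall A, var_class A -> var_class (reduct d A)) ->
  satisfies_weak_malcev V M -> satisfies_weak_malcev W M.
Proof.
move=> VW hV m; have [n hn] := hV m; exists n.
exact: satisfies_strong_interp VW hn.
Qed.

(** * Tolerances of lattices *)

(** The symbol [true] is the join and [false] the meet; indexing both by a
    boolean lets every statement be proved together with its dual. *)
Definition lattice_sig : signature := Signature (fun _ : bool => 2).

Definition pair_fun (X : Type) (x y : X) : 'I_2 -> X :=
  fun i => if i == ord0 then x else y.

Lemma pair_fun_eta (X : Type) (a : 'I_2 -> X) :
  a = pair_fun (a ord0) (a ord_max).
Proof.
apply/funext => i; rewrite /pair_fun; case: eqP => [->//|i0].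
congr a; apply/val_inj; case: i i0 => [[|[|//]] i2] //= [].
exact/val_inj.
Qed.

Definition lapp (b : bool) (t u : term lattice_sig nat) :
    term lattice_sig nat := @App lattice_sig nat b (pair_fun t u).

Inductive lattice_axiom : identity lattice_sig -> Prop :=
| LatticeC b : lattice_axiom (Identity
    (lapp b (Var 0) (Var 1)) (lapp b (Var 1) (Var 0)))
| LatticeA b : lattice_axiom (Identity
    (lapp b (Var 0) (lapp b (Var 1) (Var 2)))
    (lapp b (lapp b (Var 0) (Var 1)) (Var 2)))
| LatticeK b : lattice_axiom (Identity
    (lapp b (Var 0) (lapp (~~ b) (Var 0) (Var 1))) (Var 0)).

Lemma lattices_equational :
  exists E, forall A, models lattice_axiom A <-> models E A.
Proof. by exists lattice_axiom. Qed.

Definition lattices : variety := Variety lattices_equational.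

Definition lop (A : algebra lattice_sig) (b : bool) (x y : A) : A :=
  @oper lattice_sig A b (pair_fun x y).

Lemma eval_lapp (A : algebra lattice_sig) (e : nat -> A) b t u :
  eval e (lapp b t u) = lop b (eval e t) (eval e u).
Proof.
rewrite /= /lop; congr (oper _); apply/funext => i.
by rewrite /pair_fun; case: ifP.
Qed.

Lemma models_latticeP (A : algebra lattice_sig) :
  models lattice_axiom A <->
  [/\ forall b, commutative (@lop A b), forall b, associative (@lop A b)
    & forall b (x y : A), lop b x (lop (~~ b) x y) = x].
Proof.
split=> [h|[hC hA hK] _ [] b e]; last 3 first.
- by rewrite /ident_lhs /ident_rhs !eval_lapp; exact: hC.
- by rewrite /ident_lhs /ident_rhs !eval_lapp; exact: hA.
- by rewrite /ident_lhs /ident_rhs !eval_lapp; exact: hK.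
split=> [b x y|b x y z|b x y].
- have := h _ (LatticeC b) (nth x [:: x; y]).
  by rewrite /ident_lhs /ident_rhs !eval_lapp.
- have := h _ (LatticeA b) (nth x [:: x; y; z]).
  by rewrite /ident_lhs /ident_rhs !eval_lapp.
- have := h _ (LatticeK b) (nth x [:: x; y]).
  by rewrite /ident_lhs /ident_rhs !eval_lapp.
Qed.

Section LatticeTolerance.
Variable A : algebra lattice_sig.
Hypotheses (lopC : forall b, commutative (@lop A b))
  (lopA : forall b, associative (@lop A b))
  (lopK : forall b (x y : A), lop b x (lop (~~ b) x y) = x).

Lemma lop_idem b (x : A) : lop b x x = x.
Proof.
have := lopK (~~ b) x x; rewrite negbK => dualK.
by have := lopK b x (lop b x x); rewrite dualK.
Qed.

(** The equation [lop b x y = y] is the order in which [b] is the join, so it is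
    [x <= y] for [b = true] and [y <= x] for [b = false]. *)
Lemma le_dual b (x y : A) : lop b x y = y -> lop (~~ b) y x = x.
Proof. by move=> <-; rewrite lopC; have := lopK (~~ b) x y; rewrite negbK. Qed.

Lemma lop_mono b c (x y x' y' : A) :
  lop b x y = y -> lop b x' y' = y' ->
  lop b (lop c x x') (lop c y y') = lop c y y'.
Proof.
(* For the operation defining the order this is commutation with itself; the
   other operation is treated in the dual order. *)
have same d (u v u' v' : A) : lop d u v = v -> lop d u' v' = v' ->
    lop d (lop d u u') (lop d v v') = lop d v v'.
  move=> uv uv'.
  by rewrite -lopA (lopA d u' v) (lopC d u' v) -(lopA d v) uv' lopA uv.
have [<-|/eqP bc] := eqVneq b c; first exact: same.
have -> : c = ~~ b by case: b c bc => [] [].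
move=> xy xy'; rewrite -{1}(negbK b).
exact: (le_dual (same _ _ _ _ _ (le_dual xy) (le_dual xy'))).
Qed.

(** The composition [R \; R^-1] relates [x] and [y] when some [z] satisfies
    [R (z, x)] and [R (z, y)]. Related elements [x], [y] both lie above
    [x /\ y], which is related to both. Conversely, if [x] and [y] lie above [z] and are
    related to it, then taking joins of the pairs [(x, z)] and [(z, y)] shows
    that [x] is related to [y]. *)
Lemma lattice_tolerance_representable (Theta : set (A * A)) :
  tolerance Theta -> representable Theta.
Proof.
move=> [Trefl Tsym Tcomp].
have Tlop b x y x' y' : Theta (x, y) -> Theta (x', y') ->
    Theta (lop b x x', lop b y y').
  move=> h h'; apply: (Tcomp b) => i.
  by rewrite /pair_fun; case: ifP.
exists [set p | Theta p /\ lop true p.1 p.2 = p.2]; split.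
- move=> b a a' haa'; split; first by apply: Tcomp => i; have [] := haa' i.
  rewrite /= (pair_fun_eta a) (pair_fun_eta a').
  by apply: lop_mono; [have [] := haa' ord0 | have [] := haa' ord_max].
- by move=> x; split=> //=; exact: lop_idem.
- apply/seteqP; split=> [[x y] /= Txy|[x y] /= [z]].
    have xz : Theta (x, lop false x y).
      by have := Tlop false _ _ _ _ (Trefl x) Txy; rewrite lop_idem.
    have yz : Theta (y, lop false x y).
      have := Tlop false _ _ _ _ (Tsym _ _ Txy) (Trefl y).
      by rewrite lop_idem lopC (lopC false y).
    exists (lop false x y); split=> /=; try exact: Tsym.
    + by rewrite lopC lopK.
    + by rewrite (lopC false) lopC lopK.
  move=> [/= Tzx zx] [/= Tzy zy].
  have := Tlop true _ _ _ _ (Tsym _ _ Tzx) Tzy.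
  by rewrite (lopC true x z) zx zy.
Qed.

End LatticeTolerance.

Lemma lattice_tolerances_representable :
  all_tolerances_representable lattices.
Proof.
move=> A /models_latticeP[hC hA hK] Theta.
exact: lattice_tolerance_representable.
Qed.

Lemma representable_weakly (S : signature) (A : algebra S)
    (Theta : set (A * A)) :
  representable Theta -> weakly_representable Theta.
Proof.
move=> [R [Rcomp Rrefl ->]]; exists unit, (fun=> R); split=> //.
by rewrite bigcap_const //; exists tt.
Qed.

(** * Lattices with two unary operations *)

Definition bi_unary_lattice_sig : signature :=
  Signature (fun f : bool + bool => if f is inl _ then 2 else 1).

Definition lattice_symbol (b : lattice_sig) :
    term bi_unary_lattice_sig 'I_(arity b) :=
  @App bi_unary_lattice_sig _ (inl b) Var.

Definition bi_unary_lattices : variety :=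
  @interpreting_variety lattices bi_unary_lattice_sig lattice_symbol.

Inductive chain3 := Lo | Mid | Hi.

Definition flip (x : chain3) : chain3 :=
  match x with Lo => Hi | Mid => Mid | Hi => Lo end.

Definition swap (x : chain3) : chain3 := if x is Mid then Lo else Mid.

Definition join3 (x y : chain3) : chain3 :=
  match x, y with
  | Lo, z | z, Lo => z
  | Mid, Mid => Mid
  | _, _ => Hi
  end.

Definition chain_op (b : bool) (x y : chain3) : chain3 :=
  if b then join3 x y else flip (join3 (flip x) (flip y)).

Definition chain_algebra : algebra bi_unary_lattice_sig :=
  @Algebra bi_unary_lattice_sig chain3
    (fun f => match f with
       | inl b => fun a => chain_op b (a ord0) (a ord_max)
       | inr b => fun a => (if b then flip else swap) (a ord0)
     end)
    (inhabits Lo).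

Lemma chain_algebra_bi_unary :
  @var_class bi_unary_lattices chain_algebra.
Proof.
apply/models_latticeP; split.
- by case=> [] [] [].
- by case=> [] [] [] [].
- by case=> [] [] [].
Qed.

Definition adjacent (x y : chain3) : bool :=
  match x, y with Lo, Hi | Hi, Lo => false | _, _ => true end.

Definition adjacency : set (chain_algebra * chain_algebra) :=
  [set p | adjacent p.1 p.2].

Lemma adjacency_tolerance : tolerance adjacency.
Proof.
split=> [[]|[] []|[b|b] a a' haa'] //; rewrite /adjacency /=.
  move: (haa' ord0) (haa' ord_max); rewrite /adjacency /=.
  move: (a ord0) (a' ord0) (a ord_max) (a' ord_max).
  by case: b {a a' haa'} => [] [] [] [] [].
move: (haa' ord0); rewrite /adjacency /=; move: (a ord0) (a' ord0).
by case: b {a a' haa'} => [] [] [].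
Qed.

(** Let [z] satisfy [R (z, Lo)] and [R (z, Mid)]. If [z] is [Mid], then
    [flip] shows that [Mid] is also [R]-related to [Hi]. If [z] is [Lo], then
    [swap] turns the pair [(Lo, Mid)] into [(Mid, Lo)], and this reduces to the
    first case. If [z] is [Hi], reflexivity suffices. *)
Lemma forced_pair (R : set (chain_algebra * chain_algebra)) :
  compatible_rel R -> reflexive_rel R ->
  (R \; R^-1)%relation (Lo, Mid) -> (R \; R^-1)%relation (Lo, Hi).
Proof.
move=> Rcomp Rrefl.
have Rflip x y : R (x, y) -> R (flip x, flip y).
  by move=> h; apply: (Rcomp (inr true) (fun=> x) (fun=> y)).
have Rswap x y : R (x, y) -> R (swap x, swap y).
  by move=> h; apply: (Rcomp (inr false) (fun=> x) (fun=> y)).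
have RMidLo : R (Mid, Lo) -> (R \; R^-1)%relation (Lo, Hi).
  by move=> h; exists Mid => //; exact: (Rflip _ _ h).
move=> [[] /= RLo RMid].
- exact/RMidLo/(Rswap _ _ RMid).
- exact: RMidLo.
- by exists Hi => //; exact: Rrefl.
Qed.

Lemma adjacency_not_weakly_representable : ~ weakly_representable adjacency.
Proof.
move=> [K [R [hR eqR]]].
suff: adjacency (Lo, Hi) by [].
have LoMid : adjacency (Lo, Mid) by [].
rewrite eqR in LoMid *; move=> k _.
by have [Rcomp Rrefl] := hR k; apply: forced_pair => //; exact: LoMid.
Qed.

Theorem corollary10 :
  ~ (exists M : weak_malcev, characterized_by all_tolerances_representable M)
  /\
  ~ (exists M : weak_malcev,
       characterized_by all_tolerances_weakly_representable M).
Proof.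
have transfer M : satisfies_weak_malcev lattices M ->
    satisfies_weak_malcev bi_unary_lattices M.
  exact: (@satisfies_weak_malcev_interp lattices bi_unary_lattices
            lattice_symbol M (fun A hA => hA)).
have bad : ~ all_tolerances_weakly_representable bi_unary_lattices.
  move=> /(_ _ chain_algebra_bi_unary _ adjacency_tolerance).
  exact: adjacency_not_weakly_representable.
split=> -[M hM]; apply: bad.
  move=> A hA Theta hTheta; apply: representable_weakly.
  move: A hA Theta hTheta.
  exact/hM/transfer/hM/lattice_tolerances_representable.
apply/hM/transfer/hM => A hA Theta hTheta.
exact/representable_weakly/lattice_tolerances_representable.
Qed.
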